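(* Let $1\le p\le\infty$ and $1/p+1/q=1$. Suppose that for some $z_0\in\mathbb{C}$ all solutions $u=(u_j)_{j\ge -1}$ of the equation $$A_{j,j-1}u_{j-1}+A_{j,j}u_j+A_{j,j+1}u_{j+1}=z\,u_j,\qquad j\ge 0,\qquad (\mathrm{I})$$ with $z=z_0$ belong to $l_n^p$, and all solutions $v=(v_j)_{j\ge -1}$ of the equation $$v_{j-1}^{*}A_{j-1,j}+v_j^{*}A_{j,j}+v_{j+1}^{*}A_{j+1,j}=z\,v_j^{*},\qquad j\ge 0,\qquad (\mathrm{II})$$ with $z=z_0$ belong to $l_n^q$. Then for any $z\in\mathbb{C}$ all solutions of (I) belong to $l_n^p$ and all solutions of (II) belong to $l_n^q$.
   Context: Fix $n\ge 1$. Let $A=(A_{i,j})_{i,j=0}^\infty$ be an infinite three-diagonal block matrix: each $A_{i,j}$ is an $n\times n$ complex matrix, $A_{i,j}=O$ (zero matrix) for $|i-j|>1$, and $A_{i+1,i}$, $A_{i,i+1}$ are invertible for all $i\ge 0$. In addition set $A_{0,-1}=A_{-1,0}=-E$, where $E$ is the $n\times n$ unit matrix. The unknowns $u_j,v_j\in\mathbb{C}^n$ ($j\ge -1$) are column vectors, and $*$ denotes Hermitian conjugation (so $v_j^*$ is a row vector). For $1\le p<\infty$, $l_n^p$ is the Banach space of sequences $u=(u_{-1},u_0,u_1,\dots)$ with $u_j\in\mathbb{C}^n$ and $\|u\|_p=(\sum_j|u_j|^p)^{1/p}<\infty$, where $|\cdot|$ is a fixed vector norm on $\mathbb{C}^n$;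 $l_n^\infty$ is the space of such sequences with $\|u\|_\infty=\sup_j|u_j|<\infty$. By convention $q=\infty$ if $p=1$ and $q=1$ if $p=\infty$. *)

(* Defs.v *)
From HB Require Import structures.
From mathcomp Require Import all_boot all_order all_algebra.
From mathcomp Require Import complex.
From mathcomp Require Import all_classical all_reals all_analysis.

Set Implicit Arguments.
Unset Strict Implicit.
Unset Printing Implicit Defensive.

Import Order.TTheory GRing.Theory Num.Theory.

Local Open Scope ring_scope.
Local Open Scope complex_scope.
Local Open Scope classical_set_scope.
Local Open Scope sesquilinear_scope.

Record vector_norm (R : realType) (n : nat) := VectorNorm {
  vnorm :> 'cV[R[i]]_n -> R ;
  vnorm_triangle : forall x y, vnorm (x + y) <= vnorm x + vnorm y ;
  vnorm_homogeneous : forall (a : R[i]) x,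
    (vnorm (a *: x))%:C = `|a| * (vnorm x)%:C ;
  vnorm_definite : forall x, vnorm x = 0 -> x = 0
}.

(* A sequence (u_{-1}, u_0, u_1, ...) is encoded as u : nat -> 'cV_n with the
   indices shifted by one: u k stands for u_{k-1}. *)

(* Only exponents 1 <= p <= +oo are meant; the value at -oo is arbitrary. *)
Definition lp_norm (R : realType) (n : nat) (N : vector_norm R n) (p : \bar R)
    (u : nat -> 'cV[R[i]]_n) : \bar R :=
  match p with
  | r%:E => ((\sum_(k <oo) (N (u k) `^ r)%:E) `^ r^-1)%E
  | +oo%E => ereal_sup (range (fun k => (N (u k))%:E))
  | -oo%E => +oo%E
  end.

Definition in_lp (R : realType) (n : nat) (N : vector_norm R n) (p : \bar R)
    (u : nat -> 'cV[R[i]]_n) : Prop :=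
  (lp_norm N p u < +oo)%E.

Definition block_tridiagonal (R : realType) (n : nat)
    (A : nat -> nat -> 'M[R[i]]_n) : Prop :=
  [/\ forall i j, (i.+1 < j)%N || (j.+1 < i)%N -> A i j = 0,
      forall i, A i.+1 i \in unitmx
    & forall i, A i i.+1 \in unitmx].

(* The blocks A_{i,j} with i, j >= -1, including A_{0,-1} = A_{-1,0} = -E,
   with the same index shift as for sequences: extend A k l stands for
   A_{k-1,l-1}.  The remaining entries of the row and column of index -1
   occur in no equation. *)
Definition extend (R : realType) (n : nat) (A : nat -> nat -> 'M[R[i]]_n)
    (k l : nat) : 'M[R[i]]_n :=
  match k, l with
  | i.+1, j.+1 => A i j
  | 1, 0 | 0, 1 => - 1%:M
  | _, _ => 0
  end.

(* In the next two definitions the three terms have indices j - 1, j, j + 1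
   before the shift, with j >= 0. *)
Definition solution_I (R : realType) (n : nat) (A : nat -> nat -> 'M[R[i]]_n)
    (z : R[i]) (u : nat -> 'cV[R[i]]_n) : Prop :=
  forall j : nat,
    extend A j.+1 j *m u j + extend A j.+1 j.+1 *m u j.+1
      + extend A j.+1 j.+2 *m u j.+2 = z *: u j.+1.

Definition solution_II (R : realType) (n : nat) (A : nat -> nat -> 'M[R[i]]_n)
    (z : R[i]) (v : nat -> 'cV[R[i]]_n) : Prop :=
  forall j : nat,
    (v j)^t* *m extend A j j.+1 + (v j.+1)^t* *m extend A j.+1 j.+1
      + (v j.+2)^t* *m extend A j.+2 j.+1 = z *: (v j.+1)^t*.

(* Main.v *)
Require Import Defs.
From mathcomp Require Import all_boot all_order all_algebra.
From mathcomp Require Import complex.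
From mathcomp Require Import all_classical all_reals all_analysis.
From mathcomp Require Import ring lra.

(** Variation of constants, followed by the inequalities of Hoelder and
    Gronwall.

    Write (I) as B_{j+1,j} X_j + B_{j+1,j+1} X_{j+1} + B_{j+1,j+2} X_{j+2} =
    z X_{j+1}, and (II) as the same recurrence with the unknown rows
    Y_j = v_j^* on the left of the blocks.  If Y solves the left recurrence
    with z and X the right one with w, the Casoratian
      Y_j B_{j,j+1} X_{j+1} - Y_{j+1} B_{j+1,j} X_j
    grows by (w - z) Y_{j+1} X_{j+1} from j to j+1 ([casoratian_step]).  So it
    is constant for w = z, and since the off-diagonal blocks are invertible,
    one can choose a full set X (n x 2n) of right solutions and a full set Y
    (2n x n) of left solutions at z0 whose Casoratian is the identity of size
    2n ([fundamental_pair]).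

    Let u solve (I) with an arbitrary z, and let c_j be the Casoratian of Y
    and u.  The Casoratian of Y and X being the product of two square matrices
    of size 2n, these matrices are inverse to each other in both orders, which
    gives u_j = X_j c_j and u_{j+1} = X_{j+1} c_j ([casoratian_reconstruct]):
    the c_j are the varying constants.  By [casoratian_step],
      c_{j+1} = c_j + (z - z0) Y_{j+1} X_{j+1} c_j.
    The columns of X are in l^p and the conjugated rows of Y in l^q by
    hypothesis, so the norms of Y_j X_j are summable ([hoelder_bounded]), so c
    is bounded ([gronwall_bounded]), and u_j = X_j c_j is in l^p
    ([right_solutions_in_lp]).  Replacing each block by its adjoint, and
    transposing the block indices, exchanges (I) and (II), z and its conjugate,
    p and q, whence the claim on (II).

    The finite dimension of C^n enters through the estimate of Y_j X_j, where
    the entries of a vector are bounded by its norm ([entry_le_vnorm]). *)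

Import Order.TTheory GRing.Theory Num.Theory.
Import Normc numFieldNormedType.Exports.

Local Open Scope ring_scope.
Local Open Scope complex_scope.
Local Open Scope sesquilinear_scope.

(** * Three-term block recurrences and their Casoratian *)

(** Solutions are allowed to be matrices, so that a fundamental system is a
    single solution. *)
Definition right_solution {F : fieldType} {n m : nat} (B : nat -> nat -> 'M[F]_n)
    (z : F) (X : nat -> 'M[F]_(n, m)) : Prop :=
  forall j : nat, B j.+1 j *m X j + B j.+1 j.+1 *m X j.+1
    + B j.+1 j.+2 *m X j.+2 = z *: X j.+1.

Definition left_solution {F : fieldType} {n m : nat} (B : nat -> nat -> 'M[F]_n)
    (z : F) (Y : nat -> 'M[F]_(m, n)) : Prop :=
  forall j : nat, Y j *m B j j.+1 + Y j.+1 *m B j.+1 j.+1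
    + Y j.+2 *m B j.+2 j.+1 = z *: Y j.+1.

(** The discrete Wronskian of a left and a right solution. *)
Definition casoratian {F : fieldType} {n m k : nat} (B : nat -> nat -> 'M[F]_n)
    (Y : nat -> 'M[F]_(m, n)) (X : nat -> 'M[F]_(n, k)) (j : nat) : 'M[F]_(m, k) :=
  Y j *m B j j.+1 *m X j.+1 - Y j.+1 *m B j.+1 j *m X j.

(** Lagrange's identity in difference form: the diagonal blocks cancel, and
    what remains is the difference of the spectral parameters. *)
Lemma casoratian_step {F : fieldType} {n m k : nat} {B : nat -> nat -> 'M[F]_n}
    {z w : F} {Y : nat -> 'M[F]_(m, n)} {X : nat -> 'M[F]_(n, k)} :
  left_solution B z Y -> right_solution B w X -> forall j,
  casoratian B Y X j.+1 = casoratian B Y X j + (w - z) *: (Y j.+1 *m X j.+1).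
Proof.
move=> hY hX j; rewrite /casoratian -[_ *m B j.+1 j.+2 *m _]mulmxA.
have /(canRL (addKr _)) -> := hX j; have /(canRL (addKr _)) -> := hY j.
rewrite !(mulmxDr, mulmxDl, mulNmx, mulmxN) -!scalemxAl -!scalemxAr !mulmxA.
(* The four products involved are now opaque, and the identity is additive. *)
move: (Y j.+1 *m B j.+1 j *m X j) (Y j.+1 *m B j.+1 j.+1 *m X j.+1)
  (Y j *m B j j.+1 *m X j.+1) (Y j.+1 *m X j.+1) => a b c d.
by apply/matrixP=> i l; rewrite !mxE; ring.
Qed.

Lemma exists_right_solution {F : fieldType} {n m : nat}
    {B : nat -> nat -> 'M[F]_n} (z : F) (X0 X1 : 'M[F]_(n, m)) :
  (forall j, B j j.+1 \in unitmx) ->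
  exists X, [/\ right_solution B z X, X 0%N = X0 & X 1%N = X1].
Proof.
move=> hB.
pose step j (P : 'M[F]_(n, m) * 'M[F]_(n, m)) := (P.2, invmx (B j.+1 j.+2) *m
  (z *: P.2 - B j.+1 j *m P.1 - B j.+1 j.+1 *m P.2)).
pose P := fix P j := if j is i.+1 then step i (P i) else (X0, X1).
exists (fun j => (P j).1); split=> // j /=.
by rewrite mulKVmx // -[X in _ + X]addrA -opprD subrKC.
Qed.

Lemma exists_left_solution {F : fieldType} {n m : nat}
    {B : nat -> nat -> 'M[F]_n} (z : F) (Y0 Y1 : 'M[F]_(m, n)) :
  (forall j, B j.+1 j \in unitmx) ->
  exists Y, [/\ left_solution B z Y, Y 0%N = Y0 & Y 1%N = Y1].
Proof.
move=> hB.
pose BT k l := (B l k)^T.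
have hBT j : BT j j.+1 \in unitmx by rewrite unitmx_tr.
have [X [hX X0 X1]] := exists_right_solution z Y0^T Y1^T hBT.
exists (fun j => (X j)^T); split; rewrite ?X0 ?X1 ?trmxK // => j.
by have /(congr1 trmx) := hX j; rewrite linearZ /= !linearD /= !trmx_mul !trmxK.
Qed.

(** The Casoratian of two solutions with the same parameter is constant, so it
    suffices to choose initial data that make it the identity at 0; the data
    of Y are those dual to X_0 = (1 0) and X_1 = (0 1). *)
Lemma fundamental_pair {F : fieldType} {n : nat}
    {B : nat -> nat -> 'M[F]_n} (z : F) :
  (forall j, B j.+1 j \in unitmx) -> (forall j, B j j.+1 \in unitmx) ->
  exists (X : nat -> 'M[F]_(n, n + n)) (Y : nat -> 'M[F]_(n + n, n)),
    [/\ right_solution B z X, left_solution B z Y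
      & forall j, casoratian B Y X j = 1%:M].
Proof.
move=> hl hu.
have [X [hX X0 X1]] :=
  exists_right_solution z (row_mx 1%:M 0) (row_mx 0 1%:M) hu.
have [Y [hY Y0 Y1]] := exists_left_solution z
  (col_mx 0 (invmx (B 0%N 1%N))) (col_mx (- invmx (B 1%N 0%N)) 0) hl.
exists X, Y; split=> //; elim=> [|j IH].
  rewrite /casoratian X0 X1 Y0 Y1.
  have -> : col_mx 0 (invmx (B 0%N 1%N)) *m B 0%N 1%N =
      col_mx (0 : 'M[F]_n) 1%:M.
    by rewrite mul_col_mx mul0mx mulVmx.
  have -> : col_mx (- invmx (B 1%N 0%N)) 0 *m B 1%N 0%N =
      col_mx (- 1%:M) (0 : 'M[F]_n).
    by rewrite mul_col_mx mul0mx mulNmx mulVmx.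
  rewrite !mul_col_row !mulmx0 !mul0mx !mulmx1.
  by rewrite opp_block_mx add_block_mx !oppr0 opprK !addr0 !add0r -scalar_mx_block.
by rewrite (casoratian_step hY hX) IH subrr scale0r addr0.
Qed.

(** The Casoratian is a product L (X_{j+1}; X_j) of a row block matrix L and a
    column block matrix, both square of size n + n; L is therefore also a right
    inverse of the column block matrix, which recovers (u_{j+1}; u_j) from
    L (u_{j+1}; u_j). *)
Lemma casoratian_reconstruct {F : fieldType} {n k : nat}
    {B : nat -> nat -> 'M[F]_n}
    {X : nat -> 'M[F]_(n, n + n)} {Y : nat -> 'M[F]_(n + n, n)} {j : nat} :
  casoratian B Y X j = 1%:M -> forall u : nat -> 'M[F]_(n, k),
  X j *m casoratian B Y u j = u j /\ X j.+1 *m casoratian B Y u j = u j.+1.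
Proof.
pose L := row_mx (Y j *m B j j.+1) (- (Y j.+1 *m B j.+1 j)).
have casE l (w : nat -> 'M[F]_(n, l)) :
    casoratian B Y w j = L *m col_mx (w j.+1) (w j).
  by rewrite mul_row_col mulNmx.
rewrite casE => /mulmx1C XL1 u.
have : col_mx (X j.+1) (X j) *m casoratian B Y u j = col_mx (u j.+1) (u j).
  by rewrite casE mulmxA XL1 mul1mx.
by rewrite mul_col_mx => /eq_col_mx [-> ->].
Qed.

(** * Scalar sequences: membership in l^p, Hoelder, Gronwall *)

(** Membership in l^p of a nonnegative sequence through bounded partial sums,
    which avoids infinite sums, roots and infinite values. *)
Definition lp_sequence {R : realType} (p : \bar R) (a : nat -> R) : Prop :=
  match p with
  | r%:E => exists M, forall K, \sum_(0 <= k < K) a k `^ r <= M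
  | +oo%E => exists M, forall k, a k <= M
  | -oo%E => False
  end.

Lemma lp_sequence_le {R : realType} {p : \bar R} (C : R) {b : nat -> R}
    (a : nat -> R) :
  (1 <= p)%E -> 0 <= C -> (forall k, 0 <= a k <= C * b k) -> (forall k, 0 <= b k) ->
  lp_sequence p b -> lp_sequence p a.
Proof.
case: p => [r||] //= r1 C0 ab b0 [M hM]; last first.
  exists (C * M) => k; have /andP[_ /le_trans->//] := ab k.
  exact: ler_wpM2l.
have r0 : 0 <= r by rewrite lee_fin in r1; lra.
exists (C `^ r * M) => K.
apply: le_trans (ler_wpM2l (powR_ge0 C r) (hM K)).
rewrite mulr_sumr; apply: ler_sum => k _.
have /andP[a0 aCb] := ab k.
by rewrite -powRM // ge0_ler_powR // ?nnegrE // mulr_ge0.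
Qed.

(** Instead of Minkowski's inequality: a + b <= 2 max(a, b), and the r-th power
    of the maximum is at most the sum of the r-th powers. *)
Lemma lp_sequence_add {R : realType} {p : \bar R} {a b : nat -> R} :
  (1 <= p)%E -> (forall k, 0 <= a k) -> (forall k, 0 <= b k) ->
  lp_sequence p a -> lp_sequence p b -> lp_sequence p (fun k => a k + b k).
Proof.
case: p => [r||] //= r1 a0 b0 [M hM] [M' hM']; last first.
  by exists (M + M') => k; apply: lerD.
have r0 : 0 <= r by rewrite lee_fin in r1; lra.
exists (2 `^ r * (M + M')) => K.
apply: le_trans (ler_wpM2l (powR_ge0 2 r) (lerD (hM K) (hM' K))).
rewrite -big_split mulr_sumr /=; apply: ler_sum => k _.
have max0 : 0 <= Num.max (a k) (b k) by rewrite le_max a0.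
apply: (@le_trans _ _ ((2 * Num.max (a k) (b k)) `^ r)).
  apply: ge0_ler_powR; rewrite ?nnegrE ?addr_ge0 ?mulr_ge0 //.
  by rewrite mulrDl mul1r lerD // le_max lexx ?orbT.
rewrite powRM // ler_wpM2l ?powR_ge0 //.
by case: (leP (a k) (b k)) => _; rewrite ?lerDl ?lerDr powR_ge0.
Qed.

Lemma lp_sequence_sum {R : realType} {p : \bar R} {m : nat}
    {a : 'I_m -> nat -> R} :
  (1 <= p)%E -> (forall s k, 0 <= a s k) -> (forall s, lp_sequence p (a s)) ->
  lp_sequence p (fun k => \sum_s a s k).
Proof.
move=> p1; elim: m a => [|m IH] a a0 ha.
  have -> : (fun k => \sum_(s < 0) a s k) = fun=> 0.
    by apply/funext => k; rewrite big_ord0.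
  case: p p1 {ha} => [r||] //= r1; last by exists 0.
  exists 0 => K; rewrite big1 // => k _; rewrite powR0 //.
  by rewrite lee_fin in r1; lra.
have -> : (fun k => \sum_s a s k) =
    fun k => \sum_s a (widen_ord (leqnSn m) s) k + a ord_max k.
  by apply/funext => k; rewrite big_ord_recr.
apply: lp_sequence_add => // [k|]; first exact: sumr_ge0.
exact: IH.
Qed.

Lemma conjugate_cases {R : realType} {p q : \bar R} :
  (1 <= p)%E -> (p^-1 + q^-1 = 1)%E ->
  [\/ p = 1%E /\ q = +oo%E, p = +oo%E /\ q = 1%E
    | exists r s, [/\ p = r%:E, q = s%:E, 0 < r, 1 <= s & r^-1 + s^-1 = 1]].
Proof.
case: p => [r||] //; last first.
  move=> _; rewrite invey add0e => /eqP.
  by rewrite inve_eq1 => /eqP; constructor 2.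
rewrite lee_fin => r1; have r0 : 0 < r by lra.
rewrite inver gt_eqF //; case: inveP => [||| s s0] //.
- rewrite adde0 => -[] /(congr1 GRing.inv); rewrite invrK invr1 => ->.
  by constructor 1.
- rewrite -EFinD => -[rs]; constructor 3; exists r, s; split=> //.
  have s'1 : s^-1 <= 1 by rewrite -rs lerDr invr_ge0 ltW.
  have r'1 : r^-1 <= 1 by rewrite invf_le1.
  have s'0 : 0 < s^-1 by rewrite lt_def invr_eq0 s0 /=; lra.
  by rewrite -[s]invrK invf_ge1.
Qed.

(** Only boundedness is claimed, so Young's inequality applied termwise is
    enough for finite exponents. *)
Lemma hoelder_bounded {R : realType} {p q : \bar R} {a b : nat -> R} :
  (1 <= p)%E -> (p^-1 + q^-1 = 1)%E ->
  (forall k, 0 <= a k) -> (forall k, 0 <= b k) ->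
  lp_sequence p a -> lp_sequence q b ->
  exists M, forall K, \sum_(0 <= k < K) a k * b k <= M.
Proof.
move=> p1 pq a0 b0.
have bounded (c d : nat -> R) M M' :
    (forall k, 0 <= c k) -> (forall k, 0 <= d k) ->
    (forall K, \sum_(0 <= k < K) c k `^ 1 <= M) -> (forall k, d k <= M') ->
    forall K, \sum_(0 <= k < K) c k * d k <= M * M'.
  move=> c0 d0 hM hM' K; have M'0 := le_trans (d0 0%N) (hM' 0%N).
  apply: le_trans (ler_wpM2r M'0 (hM K)); rewrite mulr_suml.
  by apply: ler_sum => k _; rewrite powRr1 // ler_wpM2l.
case: (conjugate_cases p1 pq) => [[-> ->]|[-> ->]|[r [s [-> -> r0 s1 rs]]]] /=
  [M hM] [M' hM'].
- by exists (M * M'); apply: bounded.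
- exists (M' * M) => K; under eq_bigr do rewrite mulrC.
  exact: bounded.
- have s0 : 0 < s by lra.
  exists (M / r + M' / s) => K.
  apply: le_trans (lerD (ler_wpM2r (ltW _) (hM K)) (ler_wpM2r (ltW _) (hM' K)));
    rewrite ?invr_gt0 //.
  rewrite !mulr_suml -big_split /=; apply: ler_sum => k _.
  exact: conjugate_powR.
Qed.

(** For p = r finite, the 1/r-th power of the series is finite only if the
    series is, because the exponent is not zero. *)
Lemma in_lpE {R : realType} {n : nat} {N : vector_norm R n} {p : \bar R}
    {u : nat -> 'cV[R[i]]_n} :
  (1 <= p)%E -> in_lp N p u <-> lp_sequence p (fun k => N (u k)).
Proof.
rewrite /in_lp; case: p => [r||] //=; last first.
  move=> _; split=> [|[M hM]].
    case E : (ereal_sup _) => [M||] // _; last first.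
      suff : ((N (u 0%N))%:E <= -oo)%E by [].
      by rewrite -E; apply: ereal_sup_ubound; exists 0%N.
    by exists M => k; rewrite -lee_fin -E; apply: ereal_sup_ubound; exists k.
  apply: (@le_lt_trans _ _ M%:E); last exact: ltry.
  by apply: ge_ereal_sup => _ [k _ <-]; rewrite lee_fin.
rewrite lee_fin => r1; have r0 : r != 0 by lra.
have ge0 k : (0 <= (N (u k) `^ r)%:E)%E by rewrite lee_fin powR_ge0.
split=> [hlt|[M hM]].
  have : (\sum_(0 <= k <oo) (N (u k) `^ r)%:E < +oo)%E.
    rewrite ltey; apply/eqP => E; move: hlt.
    by rewrite E poweRyr ?invr_eq0 // ltxx.
  rewrite -ge0_fin_numE ?nneseries_ge0 // => /fineK E.
  exists (fine (\sum_(0 <= k <oo) (N (u k) `^ r)%:E)%E) => K.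
  by rewrite -lee_fin E -sumEFin; apply: nneseries_lim_ge.
apply/poweR_lty/(@le_lt_trans _ _ M%:E); last exact: ltry.
apply: lime_le; first exact: is_cvg_nneseries.
by apply: nearW => K; rewrite sumEFin lee_fin.
Qed.

(** 1 + g <= exp g turns the product of the factors 1 + g_j into the exponential
    of the sum of the g_j. *)
Lemma gronwall_bounded {R : realType} {x g : nat -> R} {M : R} :
  (forall j, 0 <= x j) -> (forall j, x j.+1 <= x j * (1 + g j)) ->
  (forall K, \sum_(0 <= k < K) g k <= M) ->
  forall j, x j <= x 0%N * expR M.
Proof.
move=> x0 hx hM j.
apply: (@le_trans _ _ (x 0%N * expR (\sum_(0 <= k < j) g k))); last first.
  by rewrite ler_wpM2l // ler_expR.
elim: j => [|j IH]; first by rewrite big_geq // expR0 mulr1.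
rewrite big_nat_recr //= expRD mulrA.
apply: (le_trans (hx j)); apply: (le_trans (ler_wpM2l (x0 j) (expR_ge1Dx _))).
by rewrite ler_wpM2r ?expR_ge0.
Qed.

(** * Vector norms on C^n *)

Lemma normc_ge0 {R : rcfType} (z : R[i]) : 0 <= normc z.
Proof. by case: z => a b; exact: sqrtr_ge0. Qed.

Lemma normc_le_parts {R : rcfType} (a b : R) : normc (a +i* b) <= `|a| + `|b|.
Proof.
have -> : a +i* b = (a +i* 0) + (0 +i* b) by simpc.
apply: le_trans (le_normcD _ _) _ => /=.
by rewrite expr0n addr0 add0r !sqrtr_sqr.
Qed.

Section VectorNorm.
Context {R : realType} {n : nat} (N : vector_norm R n).

Lemma vnormZ (a : R[i]) x : N (a *: x) = normc a * N x.
Proof.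
have := vnorm_homogeneous N a x.
have -> : `|a| = (normc a)%:C by case: a.
by rewrite -rmorphM => /complexI.
Qed.

Lemma vnorm0 : N 0 = 0.
Proof. by rewrite -(scale0r 0) vnormZ normc0 mul0r. Qed.

Lemma vnormN x : N (- x) = N x.
Proof. by rewrite -scaleN1r vnormZ normcN normc1 mul1r. Qed.

Lemma vnorm_ge0 x : 0 <= N x.
Proof.
have := vnorm_triangle N x (- x).
by rewrite subrr vnorm0 vnormN -mulr2n pmulrn_lge0.
Qed.

Lemma vnorm_sum {I : finType} (f : I -> 'cV[R[i]]_n) :
  N (\sum_i f i) <= \sum_i N (f i).
Proof.
elim/big_ind2: _ => [|x a y b xa yb|//]; first by rewrite vnorm0.
exact: le_trans (vnorm_triangle _ _ _) (lerD xa yb).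
Qed.

Lemma vnorm_mulmx {m : nat} (M : 'M[R[i]]_(n, m)) (c : 'cV[R[i]]_m) :
  N (M *m c) <= (\sum_t N (col t M)) * \sum_t normc (c t 0).
Proof.
have -> : M *m c = \sum_t c t 0 *: col t M.
  apply/colP => i; rewrite mxE summxE; apply: eq_bigr => t _.
  by rewrite !mxE mulrC.
apply: le_trans (vnorm_sum _) _; rewrite mulr_sumr; apply: ler_sum => t _.
rewrite vnormZ mulrC ler_wpM2r //; first exact: normc_ge0.
rewrite (bigD1 t) //= lerDl sumr_ge0 // => s _; exact: vnorm_ge0.
Qed.

End VectorNorm.

Lemma normc_sum {R : realType} {I : finType} (f : I -> R[i]) :
  normc (\sum_i f i) <= \sum_i normc (f i).
Proof.
elim/big_ind2: _ => [|x a y b xa yb|//]; first by rewrite normc0.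
exact: le_trans (le_normcD _ _) (lerD xa yb).
Qed.

(** The nontrivial half of the equivalence of norms in finite dimension.
    Through real and imaginary parts C^n is R^(n + n) with its maximum norm;
    there N is Lipschitz, hence attains a minimum on the compact unit sphere,
    which is positive as N is definite; homogeneity concludes. *)
Lemma entry_le_vnorm {R : realType} {n : nat} (N : vector_norm R n) :
  exists2 C : R, 0 <= C & forall (x : 'cV[R[i]]_n) k, normc (x k 0) <= C * N x.
Proof.
pose cplx (w : 'rV[R]_(n + n)) : 'cV[R[i]]_n :=
  \col_k (w 0 (lshift n k) +i* w 0 (rshift n k)).
pose coords (x : 'cV[R[i]]_n) : 'rV[R]_(n + n) :=
  row_mx (\row_k complex.Re (x k 0)) (\row_k complex.Im (x k 0)).
have coordsK x : cplx (coords x) = x.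
  by apply/colP => k; rewrite mxE row_mxEl row_mxEr !mxE; case: (x k 0).
have cplxK w : coords (cplx w) = w.
  apply/rowP => l; case: (split_ordP l) => k ->.
    by rewrite row_mxEl !mxE.
  by rewrite row_mxEr !mxE.
have cplxB w w' : cplx (w - w') = cplx w - cplx w'.
  by apply/colP => k; rewrite !mxE; simpc.
have cplxZ (a : R) w : cplx (a *: w) = a%:C *: cplx w.
  by apply/colP => k; rewrite !mxE /=; simpc.
have cplx_le w k : normc (cplx w k 0) <= 2 * `|w|.
  have coord_le l : `|w 0 l| <= `|w|.
    by rewrite [leRHS]mx_normrE; apply/bigmax_geP; right => /=; exists (0, l).
  rewrite mxE; apply: le_trans (normc_le_parts _ _) _.
  by rewrite mulr_natl mulr2n lerD.
pose f w := N (cplx w).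
pose L := (\sum_k N (col k 1%:M)) * (2 * n%:R).
have L0 : 0 <= L.
  by rewrite !mulr_ge0 // sumr_ge0 // => k _; exact: vnorm_ge0.
have f_le w : f w <= L * `|w|.
  rewrite /f -[cplx w]mul1mx; apply: le_trans (vnorm_mulmx _ _ _) _.
  rewrite -mulrA ler_wpM2l ?sumr_ge0 // => [k _|]; first exact: vnorm_ge0.
  apply: le_trans (ler_sum _ (fun k _ => cplx_le w k)) _.
  by rewrite sumr_const card_ord -[_ *+ n]mulr_natr mulrAC.
have f_lip w w' : `|f w - f w'| <= L * `|w - w'|.
  have half v v' : f v - f v' <= L * `|v - v'|.
    apply: le_trans (f_le _); rewrite lerBlDr /f cplxB.
    by have := vnorm_triangle N (cplx v - cplx v') (cplx v'); rewrite subrK.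
  by rewrite ler_norml half andbT lerNl opprB distrC half.
have f_cont : continuous f.
  move=> w; apply/(@cvgrPdist_le _ _ _ (nbhs w) _ f (f w)) => e e0; near=> w'.
  have ww' : `|w - w'| <= e / (L + 1).
    by near: w'; apply: cvgr_dist_le => //; rewrite divr_gt0 // ltr_wpDl.
  apply: le_trans (f_lip w w') _; apply: le_trans (ler_wpM2l L0 ww') _.
  by rewrite mulrCA ler_piMr ?(ltW e0) // ler_pdivrMr ?ltr_wpDl // mul1r lerDl.
pose S := [set w : 'rV[R]_(n + n) | `|w| = 1]%classic.
have cS : compact S.
  apply: bounded_closed_compact.
    by exists 1; split=> // x x1 w /= ->; exact: ltW.
  apply: (@preimage_closed _ _ (Num.norm : 'rV[R]_(n + n) -> R) [set 1]%classic).
    by move=> x _; exact: norm_continuous.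
  exact: closed_eq.
have S_normalize w : w != 0 -> S (`|w|^-1 *: w).
  by move=> w0; rewrite /S /= normrZ normfV normr_id mulVf ?normr_eq0.
have [S0|S0] := pselect (S !=set0)%classic; last first.
  (* Without unit vectors the space is null, that is, n = 0. *)
  exists 0 => // x k; rewrite -(coordsK x).
  have [->|/S_normalize Sx] := eqVneq (coords x) 0; last first.
    by case: S0; eexists; exact: Sx.
  by have := cplx_le 0 k; rewrite normr0 mulr0 mul0r.
have [w0 /set_mem w0S fmin] :=
  compact_EVT_min S0 cS (continuous_subspaceT f_cont).
have m0 : 0 < f w0.
  rewrite lt_def vnorm_ge0 andbT; apply/eqP => /vnorm_definite w00.
  have w0_eq0 : w0 = 0.
    rewrite -(cplxK w0) w00; apply/rowP => l.
    by case: (split_ordP l) => k ->; rewrite ?row_mxEl ?row_mxEr !mxE.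
  by move: w0S; rewrite /S /= w0_eq0 normr0 => /eqP; rewrite eq_sym oner_eq0.
exists (2 / f w0) => [|x k]; first by rewrite divr_ge0 // ltW.
rewrite -(coordsK x); apply: le_trans (cplx_le _ _) _.
rewrite -mulrA ler_wpM2l // ler_pdivlMl //.
have [->|w_neq0] := eqVneq (coords x) 0; first by rewrite normr0 mulr0 vnorm_ge0.
have := fmin _ (mem_set (S_normalize _ w_neq0)).
rewrite /f cplxZ vnormZ /= expr0n addr0 sqrtr_sqr normfV normr_id.
by rewrite ler_pdivlMl ?normr_gt0 // mulrC.
Unshelve. all: by end_near. Qed.

(** * Solutions for all values of the parameter *)

Lemma normc_conj {R : rcfType} (z : R[i]) : normc (z^*)%R = normc z.
Proof. by case: z => a b /=; rewrite sqrrN. Qed.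

(** The rows of Y are measured as the columns row^*, since it is the columns v
    with Y = v^* that are known to be in l^q. *)
Lemma mulmx_norm_bound {R : realType} {n m : nat} (N : vector_norm R n) :
  exists2 D : R, 0 <= D & forall (Y : 'M[R[i]]_(m, n)) (u : 'cV[R[i]]_n),
    \sum_s normc ((Y *m u) s 0) <= D * (\sum_s N ((row s Y)^t*)) * N u.
Proof.
have [C C0 hC] := entry_le_vnorm N.
exists (n%:R * (C * C)) => [|Y u]; first by rewrite !mulr_ge0.
rewrite mulr_sumr mulr_suml; apply: ler_sum => s _.
rewrite mxE; apply: le_trans (normc_sum _) _.
apply: (@le_trans _ _ (\sum_(k < n) C * N ((row s Y)^t*) * (C * N u))).
  apply: ler_sum => k _; rewrite normcM ler_pM ?normc_ge0 //.
  by have := hC ((row s Y)^t*) k; rewrite !mxE normc_conj.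
rewrite sumr_const card_ord -[_ *+ n]mulr_natl.
by rewrite le_eqVlt; apply/orP; left; apply/eqP; ring.
Qed.

Lemma col_solution {F : fieldType} {n m : nat} {B : nat -> nat -> 'M[F]_n}
    {z : F} {X : nat -> 'M[F]_(n, m)} (t : 'I_m) :
  right_solution B z X -> right_solution B z (fun j => col t (X j)).
Proof. by move=> hX j; rewrite !colE !mulmxA -!mulmxDl hX scalemxAl. Qed.

Lemma row_solution {F : fieldType} {n m : nat} {B : nat -> nat -> 'M[F]_n}
    {z : F} {Y : nat -> 'M[F]_(m, n)} (s : 'I_m) :
  left_solution B z Y -> left_solution B z (fun j => row s (Y j)).
Proof. by move=> hY j; rewrite -!row_mul -!linearD hY linearZ. Qed.

(** Here c is the vector of varying constants and x its l^1 norm; a and b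
    dominate the norms of the columns of X and of the rows of Y, so that
    x_{j+1} <= x_j (1 + g_j) with g summable. *)
Lemma right_solutions_in_lp {R : realType} {n : nat} {N : vector_norm R n}
    {B : nat -> nat -> 'M[R[i]]_n} {p q : \bar R} {z0 : R[i]} :
  (forall j, B j.+1 j \in unitmx) -> (forall j, B j j.+1 \in unitmx) ->
  (1 <= p)%E -> (1 <= q)%E -> (p^-1 + q^-1 = 1)%E ->
  (forall u : nat -> 'cV[R[i]]_n, right_solution B z0 u -> in_lp N p u) ->
  (forall v : nat -> 'cV[R[i]]_n,
    left_solution B z0 (fun j => (v j)^t*) -> in_lp N q v) ->
  forall (z : R[i]) (u : nat -> 'cV[R[i]]_n), right_solution B z u -> in_lp N p u.
Proof.
move=> hl hu p1 q1 pq hR hL z u hu_sol.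
have [X [Y [hX hY XY1]]] := fundamental_pair z0 hl hu.
pose a j := \sum_t N (col t (X j)).
pose b j := \sum_s N ((row s (Y j))^t*).
have a0 j : 0 <= a j by apply: sumr_ge0 => t _; exact: vnorm_ge0.
have b0 j : 0 <= b j by apply: sumr_ge0 => t _; exact: vnorm_ge0.
have a_lp : lp_sequence p a.
  apply: lp_sequence_sum => // [t k|t]; first exact: vnorm_ge0.
  by apply/in_lpE => //; apply/hR/col_solution.
have b_lp : lp_sequence q b.
  apply: lp_sequence_sum => // [s k|s]; first exact: vnorm_ge0.
  apply/in_lpE => //; apply: hL.
  have -> : (fun j => ((row s (Y j))^t*)^t*) = fun j => row s (Y j).
    by apply/funext => j; rewrite trmxCK.
  exact: row_solution.
pose c j := casoratian B Y u j.
pose x j := \sum_s normc (c j s 0).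
have x0 j : 0 <= x j by apply: sumr_ge0 => s _; exact: normc_ge0.
have Xc j : X j *m c j = u j by case: (casoratian_reconstruct (XY1 j) u).
have Xc' j : X j.+1 *m c j = u j.+1 by case: (casoratian_reconstruct (XY1 j) u).
have u_le j : N (u j.+1) <= a j.+1 * x j by rewrite -Xc' vnorm_mulmx.
have [D D0 hD] := @mulmx_norm_bound R n (n + n) N.
pose g j := normc (z - z0) * D * (a j.+1 * b j.+1).
have x_step j : x j.+1 <= x j * (1 + g j).
  rewrite mulrDr mulr1 /x /c (casoratian_step hY hu_sol) -/(c j).
  apply: (@le_trans _ _ (\sum_s (normc (c j s 0)
      + normc (z - z0) * normc ((Y j.+1 *m u j.+1) s 0)))).
    apply: ler_sum => s _; rewrite !mxE -normcM.
    exact: le_normcD.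
  rewrite big_split /= lerD2l -mulr_sumr -/(x j).
  apply: le_trans (ler_wpM2l (normc_ge0 _) (hD _ _)) _.
  rewrite -/(b j.+1).
  have coef0 : 0 <= normc (z - z0) * D * b j.+1.
    by rewrite !mulr_ge0 // normc_ge0.
  have := ler_wpM2l coef0 (u_le j).
  by congr (_ <= _); rewrite /g; ring.
have [M hM] := hoelder_bounded p1 pq a0 b0 a_lp b_lp.
have g_sum K : \sum_(0 <= j < K) g j <= normc (z - z0) * D * M.
  rewrite -mulr_sumr ler_wpM2l ?mulr_ge0 ?normc_ge0 //.
  (* g_j has the index j + 1 of a and b: these are the first K + 1 terms of
     the sum for a and b, without the term of index 0. *)
  apply: le_trans (hM K.+1).
  by rewrite big_nat_recl //= lerDr mulr_ge0.
have x_le := gronwall_bounded x0 x_step g_sum.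
apply/in_lpE => //.
apply: (lp_sequence_le (x 0%N * expR (normc (z - z0) * D * M)) _ p1 _ _ a0 a_lp).
  by rewrite mulr_ge0 ?expR_ge0.
move=> j; rewrite vnorm_ge0 /= mulrC -{1}(Xc j).
apply: le_trans (vnorm_mulmx _ _ _) _.
exact: (ler_wpM2l (a0 j) (x_le j)).
Qed.

Lemma adjoint_mul {C : numClosedFieldType} {m n k : nat}
    (M : 'M[C]_(m, n)) (M' : 'M[C]_(n, k)) : (M *m M')^t* = M'^t* *m M^t*.
Proof. by rewrite trmx_mul map_mxM. Qed.

(** Taking adjoints of the equations exchanges the two kinds of solutions. *)
Lemma left_solution_adjoint {R : realType} {n : nat}
    (B : nat -> nat -> 'M[R[i]]_n) (z : R[i]) (v : nat -> 'cV[R[i]]_n) :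
  left_solution B z (fun j => (v j)^t*) <->
  right_solution (fun k l => (B l k)^t*) (z^*)%R v.
Proof.
split=> hv j; have /(congr1 (fun M => M^t*)) := hv j.
  rewrite !linearD /= !map_mxD !adjoint_mul !trmxCK.
  by rewrite linearZ /= map_mxZ trmxCK.
rewrite !linearD /= !map_mxD !adjoint_mul !trmxCK.
by rewrite linearZ /= map_mxZ /= conjCK.
Qed.

Lemma right_solution_adjoint {R : realType} {n : nat}
    (B : nat -> nat -> 'M[R[i]]_n) (z : R[i]) (u : nat -> 'cV[R[i]]_n) :
  left_solution (fun k l => (B l k)^t*) (z^*)%R (fun j => (u j)^t*) ->
  right_solution B z u.
Proof.
by move=> /left_solution_adjoint hu j; have := hu j; rewrite !trmxCK conjCK.
Qed.

Theorem theorem1 (R : realType) (n : nat) (hn : (1 <= n)%N)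
    (N : vector_norm R n) (A : nat -> nat -> 'M[R[i]]_n)
    (hA : block_tridiagonal A)
    (p q : \bar R) (hp : (1 <= p)%E) (hpq : (p^-1 + q^-1 = 1)%E)
    (z0 : R[i])
    (hI : forall u : nat -> 'cV[R[i]]_n, solution_I A z0 u -> in_lp N p u)
    (hII : forall v : nat -> 'cV[R[i]]_n, solution_II A z0 v -> in_lp N q v) :
  forall z : R[i],
    (forall u : nat -> 'cV[R[i]]_n, solution_I A z u -> in_lp N p u) /\
    (forall v : nat -> 'cV[R[i]]_n, solution_II A z v -> in_lp N q v).
Proof.
have hq : (1 <= q)%E.
  by case: (conjugate_cases hp hpq) => [[_ ->]|[_ ->]|[r [s [_ -> _ s1 _]]]];
    rewrite ?leey ?lee_fin.
have [_ hl hu] := hA.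
have unitN1 : - 1%:M \in @unitmx R[i] n.
  by rewrite -scaleN1r unitmxZ ?unitrN1 ?unitmx1.
have unit_l j : extend A j.+1 j \in unitmx.
  by case: j => [|j] /=; rewrite ?unitN1 ?hl.
have unit_u j : extend A j j.+1 \in unitmx.
  by case: j => [|[|j]] /=; rewrite ?unitN1 ?hu.
move=> z; split.
  exact: (right_solutions_in_lp unit_l unit_u hp hq hpq hI hII).
move=> v /left_solution_adjoint.
(* The second claim is the first one for the adjoint blocks. *)
have unitC (M : 'M[R[i]]_n) : M \in unitmx -> M^t* \in unitmx.
  by rewrite map_unitmx unitmx_tr.
apply: (@right_solutions_in_lp _ _ _ _ q p (z0^*)%R) => //.
- by move=> j; exact/unitC/unit_u.
- by move=> j; exact/unitC/unit_l.
- by rewrite addeC.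
- by move=> w /left_solution_adjoint; exact: hII.
- by move=> w /right_solution_adjoint; exact: hI.
Qed.
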